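(* Let $r\ge 2$ be a prime and assume that there exists a finite group $H$ such that $\mathrm{Prob}_r(H)=1-\frac{1}{|R|}$ for an elementary abelian Sylow $r$-subgroup $R$ of $H$. Then the set \[T=\{\mathrm{Prob}_r(G) \mid G \text{ is an arbitrary finite group}\}\] is dense in $[0,1]$.
   Context: For a finite group $G$ and an integer $r\ge 2$, let $G^r=\{g^r \mid g\in G\}$ be the set of all elements of $G$ having at least one $r$-th root in $G$ (a subset of $G$, in general not a subgroup), and define $\mathrm{Prob}_r(G)=\frac{|G^r|}{|G|}$. In the set $T$ the prime $r$ is fixed and $G$ ranges over all finite groups. *)

(* Defs.v *)
From HB Require Import structures.
From mathcomp Require Import all_boot all_order all_algebra all_fingroup all_solvable.
From mathcomp Require Import all_classical all_reals all_analysis.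
Import Order.TTheory GRing.Theory Num.Theory.
Import numFieldNormedType.Exports.

Set Implicit Arguments.
Unset Strict Implicit.
Unset Printing Implicit Defensive.

Local Open Scope ring_scope.

Definition rth_powers (gT : finGroupType) (r : nat) (G : {group gT}) : {set gT} :=
  [set (g ^+ r)%g | g in G]%SET.

Definition Prob (R : realType) (gT : finGroupType) (r : nat) (G : {group gT}) : R :=
  #|rth_powers r G|%:R / #|G|%:R.

Definition Prob_values (R : realType) (r : nat) : set R :=
  [set x : R | exists (gT : finGroupType) (G : {group gT}), x = Prob R r G]%classic.

Arguments Prob_values R r : clear implicits.

Definition dense_in (X : topologicalType) (A B : set X) : Prop :=
  (A `<=` B /\ B `<=` closure A)%classic.

(* Main.v *)
(** For q = r^k, the affine group x |-> u x + b of the field with q elements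
    satisfies Prob_r = 1 - 1/q: an element with u != 1 is conjugate to a
    homothety, hence equal to its own q-th power and an r-th power, while an
    r-th root of a translation must be a translation, and these have order
    dividing r. As Prob_r is multiplicative on direct products, all powers of
    a = 1 - 1/q are values of Prob_r. Consecutive powers of a differ by at most
    1 - a = 1/q and they decrease to 0, so letting k grow gives density. *)
Require Import Defs.
From mathcomp Require Import all_boot all_order all_algebra all_fingroup all_solvable.
From mathcomp Require Import all_field.
From mathcomp Require Import all_classical all_reals all_analysis.
Import Order.TTheory GRing.Theory Num.Theory.
Import numFieldNormedType.Exports.

Local Open Scope ring_scope.

Section AffineGroup.
Set Implicit Arguments.
Unset Strict Implicit.
Variable F : finFieldType.
Implicit Types (u v : {unit F}) (b c : F).

Definition affine_fun u b (x : F) : F := FinRing.uval u * x + b.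

Lemma affine_fun_inj u b : injective (affine_fun u b).
Proof. by move=> x y /addIr; apply: mulrI; apply: (valP u). Qed.

Definition affine u b : {perm F} := perm (@affine_fun_inj u b).

Lemma affineE u b x : affine u b x = FinRing.uval u * x + b.
Proof. by rewrite permE. Qed.

(** The value at 0 recovers the translation part, and the value at 1 then recovers the linear
    part. *)
Lemma affine_inj : injective (fun p => affine p.1 p.2).
Proof.
move=> [u b] [v c] /permP eq_uv.
have := eq_uv 0; rewrite !affineE !mulr0 !add0r /= => ->.
have := eq_uv 1; rewrite !affineE !mulr1 /=.
have := eq_uv 0; rewrite !affineE !mulr0 !add0r /= => -> /addIr eq_u.
by congr (_, _); apply: val_inj.
Qed.

(** Permutations compose from left to right: the right factor acts last, so its linear part
    multiplies [b]. *)
Lemma affineM u b v c :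
  (affine u b * affine v c)%g = affine (u * v)%g (FinRing.uval v * b + c).
Proof.
apply/permP => x; rewrite permM !affineE FinRing.val_unitM.
by rewrite mulrDr addrA mulrA [FinRing.uval v * _]mulrC.
Qed.

Lemma affine1 : affine 1%g 0 = 1%g.
Proof. by apply/permP => x; rewrite affineE perm1 FinRing.val_unit1 mul1r addr0. Qed.

Definition affine_set : {set {perm F}} := [set affine p.1 p.2 | p in [set: {unit F} * F]]%SET.

Lemma affine_group_set : group_set affine_set.
Proof.
apply/group_setP; split.
  by apply/imsetP; exists (1%g, 0); rewrite ?inE //= affine1.
move=> _ _ /imsetP[[u b] _ ->] /imsetP[[v c] _ ->] /=.
apply/imsetP; exists ((u * v)%g, FinRing.uval v * b + c); rewrite ?inE //=.
by rewrite affineM.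
Qed.

Canonical affine_group := Group affine_group_set.

Lemma card_affine_group : #|affine_group| = (#|F|.-1 * #|F|)%N.
Proof.
rewrite card_imset; last exact: affine_inj.
by rewrite cardsT card_prod -card_finField_unit cardsT.
Qed.

Lemma affineX_translation b n : (affine 1%g b ^+ n)%g = affine 1%g (b *+ n).
Proof.
elim: n => [|n IHn]; first by rewrite affine1.
by rewrite expgSr IHn affineM mulg1 FinRing.val_unit1 mul1r mulrSr.
Qed.

(* The translation part is chosen so that the map fixes [c]. *)
Lemma affineX_fixpoint u c n :
  (affine u (c - FinRing.uval u * c) ^+ n)%g
  = affine (u ^+ n)%g (c - FinRing.uval (u ^+ n)%g * c).
Proof.
elim: n => [|n IHn].
  by rewrite FinRing.val_unit1 mul1r subrr affine1.
rewrite expgSr IHn affineM -expgSr; congr affine.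
rewrite expgSr FinRing.val_unitM mulrBr addrC addrA subrK.
by rewrite mulrA [FinRing.uval u * _]mulrC.
Qed.

Lemma affineX_card u b : u != 1%g -> (affine u b ^+ #|F|)%g = affine u b.
Proof.
move=> u_neq1.
have u1 : 1 - FinRing.uval u != 0.
  apply: contra u_neq1; rewrite subr_eq0 => /eqP u1.
  by apply/eqP/val_inj; rewrite /= -u1.
(* The fixed point of the map, that is, the solution of [u c + b = c]. Powers keep it fixed and only
   change the linear part, where [u ^+ #|F|] is [u]. *)
pose c := b / (1 - FinRing.uval u).
have -> : b = c - FinRing.uval u * c.
  by rewrite -{1}[c]mul1r -mulrBl mulrC divfK.
rewrite affineX_fixpoint.
suff -> : (u ^+ #|F|)%g = u by [].
by apply: val_inj; rewrite /= FinRing.val_unitX; apply: expf_card.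
Qed.

Variables (r k : nat).
Hypothesis pcharFr : r \in [pchar F].
Hypothesis k_gt0 : (0 < k)%N.
Hypothesis cardF : #|F| = (r ^ k)%N.

Lemma mem_rth_powers_affine u b :
  (affine u b \in rth_powers r affine_group) = (u != 1%g) || (b == 0).
Proof.
have aff_in v c : affine v c \in affine_group by apply/imsetP; exists (v, c).
case: (eqVneq u 1%g) => [->|u1] /=; last first.
  (* The [r]-th power of this witness is the [r ^ k]-th power of the map, which is the map
     itself. *)
  apply/imsetP; exists (affine u b ^+ (r ^ k.-1))%g; first by rewrite groupX.
  by rewrite -expgM -expnSr prednK // -cardF affineX_card.
apply/imsetP/eqP => [[_ /imsetP[[v c] _ ->]] /= | ->]; last first.
  by exists 1%g; rewrite ?group1 // expg1n affine1.
case: (eqVneq v 1%g) => [->|v1 vr].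
  rewrite affineX_translation -(mulr_natr c) (pcharf0 pcharFr) mulr0.
  by case/(@affine_inj (_, _) (_, _)).
(* A root with [v != 1] equals its own [r ^ k]-th power. As [k > 0], that is a power of its [r]-th
   power, a translation, which forces [v = 1]. *)
have := affineX_card c v1.
rewrite cardF -(prednK k_gt0) expnS expgM -vr affineX_translation.
by case/(@affine_inj (_, _) (_, _)) => v1'; rewrite -v1' eqxx in v1.
Qed.

Lemma card_rth_powers_affine :
  #|rth_powers r affine_group| = (#|F|.-1 * #|F|.-1)%N.
Proof.
(* Parameters of the nontrivial translations, the only elements without an [r]-th root. With
   [q = #|F|] there are [q - 1] of them among [(q - 1) q] elements. *)
pose B := [set p : {unit F} * F | (p.1 == 1%g) && (p.2 != 0)]%SET.
have -> : rth_powers r affine_group = [set affine p.1 p.2 | p in ~: B]%SET.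
  apply/setP => s; apply/idP/imsetP => [s_pow|[[u b]]].
    have /imsetP[[u b] _ def_s] : s \in affine_group.
      by case/imsetP: s_pow => g gG ->; rewrite groupX.
    exists (u, b) => //; rewrite !inE negb_and negbK.
    by rewrite -mem_rth_powers_affine -def_s.
  by rewrite !inE negb_and negbK /= -mem_rth_powers_affine => ? ->.
rewrite card_imset; last exact: affine_inj.
have -> : B = finset.setX [set 1%g]%SET [set~ 0]%SET.
  by apply/setP => -[u b]; rewrite !inE.
have := cardsC (finset.setX [set (1%g : {unit F})] [set~ (0 : F)])%SET.
rewrite cardsX cards1 mul1n cardsC1 card_prod -[#|{: {unit F}}|]cardsT card_finField_unit.
move=> /eqP; rewrite -{3}(prednK (ltnW (finNzRing_gt1 F))) mulnS.
by rewrite eqn_add2l => /eqP.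
Qed.

Lemma Prob_affine_group (R : realType) :
  Prob R r affine_group = 1 - (#|F|%:R)^-1.
Proof.
rewrite /Prob card_rth_powers_affine card_affine_group.
have q_gt1 := finNzRing_gt1 F.
have q0 : #|F|%:R != 0 :> R by rewrite pnatr_eq0 -lt0n ltnW.
have q1 : #|F|.-1%:R != 0 :> R by rewrite pnatr_eq0 -lt0n -ltnS prednK ?(ltnW q_gt1).
rewrite !natrM -mulf_div divff // mul1r -subn1 natrB ?(ltnW q_gt1) //.
by rewrite mulrBl divff // mul1r.
Qed.

End AffineGroup.

Section ProbValues.
Set Implicit Arguments.
Unset Strict Implicit.
Variables (R : realType) (r : nat).

(** Powers in a direct product are coordinatewise, and roots in the two factors can be chosen
    independently. *)
Lemma rth_powers_setX (gT hT : finGroupType) (G : {group gT}) (H : {group hT}) :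
  rth_powers r (setX_group G H) = finset.setX (rth_powers r G) (rth_powers r H).
Proof.
have pairX (x : gT) (y : hT) n : ((x, y) ^+ n = (x ^+ n, y ^+ n))%g.
  by elim: n => // n IHn; rewrite !expgS IHn.
apply/setP => -[x y]; rewrite finset.in_setX.
apply/imsetP/andP => [[[g h] /finset.setXP[gG hH]] | [/imsetP[g gG ->] /imsetP[h hH ->]]].
  by rewrite pairX => -[-> ->]; split; apply: imset_f.
by exists (g, h); rewrite ?pairX //; apply/finset.setXP.
Qed.

Lemma Prob_setX (gT hT : finGroupType) (G : {group gT}) (H : {group hT}) :
  Prob R r (setX_group G H) = Prob R r G * Prob R r H.
Proof. by rewrite /Prob rth_powers_setX !cardsX !natrM mulf_div. Qed.

Lemma Prob_values1 : Prob_values R r 1.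
Proof.
exists {perm unit}, [1 {perm unit}]%G; rewrite /Prob /rth_powers imset_set1 expg1n cards1.
by rewrite divr1.
Qed.

Lemma Prob_valuesX x n : Prob_values R r x -> Prob_values R r (x ^+ n).
Proof.
move=> [gT [G ->]]; elim: n => [|n [hT [H IHn]]]; first exact: Prob_values1.
by exists (gT * hT)%type, (setX_group G H); rewrite Prob_setX exprS IHn.
Qed.

Lemma Prob_ge0 (gT : finGroupType) (G : {group gT}) : 0 <= Prob R r G.
Proof. by rewrite /Prob divr_ge0. Qed.

Lemma Prob_le1 (gT : finGroupType) (G : {group gT}) : Prob R r G <= 1.
Proof.
by rewrite /Prob ler_pdivrMr ?ltr0n ?cardG_gt0 // mul1r ler_nat leq_imset_card.
Qed.

Lemma Prob_values_1subVX k :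
  prime r -> (0 < k)%N -> Prob_values R r (1 - ((r ^ k)%:R)^-1).
Proof.
move=> r_prime k_gt0; have [F pcharFr cardF] := PrimePowerField r_prime k_gt0.
by exists {perm F}, (affine_group F); rewrite (Prob_affine_group pcharFr k_gt0) ?cardF.
Qed.

End ProbValues.

(** The least [n] with [a ^+ n < y + e] works: the preceding power is at least [y + e], and one more
    factor [a] lowers it by at most [1 - a < e]. *)
Lemma powers_near (R : realType) (a y e : R) :
  0 < a < 1 -> 0 <= y <= 1 -> 1 - a < e -> exists n, `|y - a ^+ n| < e.
Proof.
move=> /andP[a_gt0 a_lt1] /andP[y_ge0 y_le1] ae.
have e_gt0 : 0 < e by apply: lt_trans ae; rewrite subr_gt0.
have ex_n : exists n, a ^+ n < y + e.
  have a_norm : `|a| < 1 by rewrite gtr0_norm.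
  have /cvgrPdist_lt/(_ e e_gt0)[N _ /(_ N (leqnn N))] := cvg_expr a_norm.
  rewrite sub0r normrN ger0_norm ?exprn_ge0 ?ltW // => aN.
  by exists N; rewrite ltr_wpDl.
case: (ex_minnP ex_n) => n an min_n; exists n.
rewrite ltr_distlC; apply/andP; split; last by [].
(* For [n = 0] there is no preceding power, but [y <= 1 = a ^+ 0] suffices. *)
case: n an min_n => [_ _|m an min_n]; first by rewrite expr0 ltrBlDr ltr_pwDr.
have am : y + e <= a ^+ m by rewrite leNgt; apply/negP => /min_n; rewrite ltnn.
have am1 : a ^+ m <= 1 by rewrite exprn_ile1 ?ltW.
have : a ^+ m * (1 - a) <= 1 - a by rewrite ler_piMl // subr_ge0 ltW.
rewrite mulrBr mulr1 -exprSr lerBlDr => am2.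
rewrite ltrBlDr; apply: (le_lt_trans (y := a ^+ m)).
  by apply: le_trans am; rewrite lerDl ltW.
by apply: le_lt_trans am2 _; rewrite addrC ltrD2l.
Qed.

Theorem theorem3p5 (R : realType) (r : nat) (r_prime : prime r)
  (exists_H : exists (hT : finGroupType) (H P : {group hT}),
      [/\ (r.-Sylow(H) P)%g, (r.-abelem P)%g & Prob R r H = 1 - 1 / #|P|%:R]) :
  dense_in (Prob_values R r) (`[0, 1]%classic : set R).
Proof.
split=> [_ [gT [G ->]] | y]; rewrite /= in_itv /=.
  by rewrite Prob_ge0 Prob_le1.
move=> y01 B /nbhs_ballP[e /= e_gt0 yeB].
have [k k_gt0 rk_e] : exists2 k, (0 < k)%N & ((r ^ k)%:R)^-1 < e.
  (* Here [r ^ k > k > e^-1]; the successor makes [k] positive. *)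
  exists (Num.bound e^-1).+1 => //.
  rewrite invf_plt ?posrE ?ltr0n ?expn_gt0 ?prime_gt0 //.
  apply: (lt_trans (archi_boundP _)); first by rewrite invr_ge0 ltW.
  by rewrite ltr_nat (ltn_trans (ltnSn _)) // ltn_expl ?prime_gt1.
have rk_gt1 : (1 < (r ^ k)%:R :> R) by rewrite ltr1n -(exp1n k) ltn_exp2r ?prime_gt1.
(* The gap [1 - a] is now [(r ^ k)^-1], already below the radius [e] of a ball around [y] inside
   [B]. *)
have [||n near_y] := @powers_near R (1 - ((r ^ k)%:R)^-1) y e _ y01.
- by rewrite subr_gt0 invf_lt1 ?(lt_trans ltr01) // rk_gt1 gtrBl invr_gt0 (lt_trans ltr01).
- by rewrite opprB addrC subrK.
exists ((1 - ((r ^ k)%:R)^-1) ^+ n); split; last exact: yeB.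
exact/Prob_valuesX/Prob_values_1subVX.
Qed.
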